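(* Let $T$ be a finite tree with $n$ vertices and maximal degree $3$. Then there is a topological embedding of $T$ into the integer grid $\mathbb{Z}^2$ which maps vertices to vertices and whose image meets at most $\frac{7}{3}n$ vertices of $\mathbb{Z}^2$.
   Context: Graphs are regarded as topological spaces ($1$-dimensional complexes). $\mathbb{Z}^2$ denotes the graph with vertex set $\mathbb{Z}\times\mathbb{Z}$ in which two vertices are adjacent exactly when they are at Euclidean distance $1$. A topological embedding is a continuous map which is a homeomorphism onto its image. *)

(* Defs.v *)
From HB Require Import structures.
From mathcomp Require Import all_boot all_order all_algebra.
From mathcomp Require Import finmap.
From mathcomp Require Import all_classical all_reals all_analysis.

Set Implicit Arguments.
Unset Strict Implicit.
Unset Printing Implicit Defensive.
Import Order.TTheory GRing.Theory Num.Theory.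
Import numFieldNormedType.Exports.
Local Open Scope classical_set_scope.
Local Open Scope ring_scope.

(* A simple graph on V is a symmetric irreflexive relation e : rel V. *)

Definition degree (V : finType) (e : rel V) (v : V) : nat := #|[set w | e v w]%SET|.

Definition max_degree (V : finType) (e : rel V) : nat := (\max_v degree e v)%N.

(* In a simple graph a closed path without repeated vertices is a cycle in the
   graph-theoretic sense exactly when it has at least 3 vertices:
   [:: x; y] with e x y is a ucycle that goes back and forth along one edge. *)
Definition acyclic (V : finType) (e : rel V) : Prop :=
  forall c : seq V, ucycle e c -> (size c <= 2)%N.

Definition is_tree (V : finType) (e : rel V) : Prop :=
  [/\ symmetric e, irreflexive e, (0 < #|V|)%N,
      (forall x y, connect e x y) & acyclic e].

(* The distance is 1 iff its square is. *)
Definition grid_adj : rel (int * int) :=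
  [rel z w | (z.1 - w.1) ^+ 2 + (z.2 - w.2) ^+ 2 == 1].

Section Realization.
Variables (R : realType) (V : eqType) (e : rel V).

Definition basis_point (v : V) : {ptws V -> R} := fun w => (w == v)%:R.

Definition segment_point (u v : V) (t : R) : {ptws V -> R} :=
  fun w => (1 - t) * basis_point u w + t * basis_point v w.

(* The 1-dimensional simplicial complex of the graph in barycentric
   coordinates: the vertices are the basis vectors of R^V, and each edge uv is
   the segment between the basis vectors of u and v. *)
Definition realization_set : set {ptws V -> R} :=
  [set p | (exists v, p = basis_point v) \/
           (exists u v t, [/\ e u v, 0 <= t <= 1 & p = segment_point u v t])].

(* The subspace topology from R^V. For a locally finite graph (such as a finite
   graph or the grid) it coincides with the CW topology of the 1-complex. *)
Definition realization : topologicalType := set_type realization_set.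

Lemma basis_point_in v : basis_point v \in realization_set.
Proof. by apply/mem_set; left; exists v. Qed.

Definition vertex (v : V) : realization := exist _ (basis_point v) (basis_point_in v).

End Realization.

Arguments basis_point R {V} v.
Arguments segment_point {R V} u v t.
Arguments realization_set R {V} e.
Arguments realization R {V} e.
Arguments vertex R {V} e v.

Definition homeomorphism (X Y : topologicalType) (h : X -> Y) : Prop :=
  continuous h /\
  exists g : Y -> X, [/\ cancel h g, cancel g h & continuous g].

Definition onto_image (X Y : Type) (f : X -> Y) (x : X) : set_type (range f) :=
  exist _ (f x) (mem_set (imageT f x)).

Definition topological_embedding (X Y : topologicalType) (f : X -> Y) : Prop :=
  continuous f /\ homeomorphism (onto_image f).

Definition vertices_met (R : realType) (X : Type) (V : eqType) (e : rel V)
    (f : X -> realization R e) : set V :=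
  [set v | range f (vertex R e v)].

(* Main.v *)
Require Import Defs.
From HB Require Import structures.
From mathcomp Require Import all_boot all_order all_algebra.
From mathcomp Require Import finmap.
From mathcomp Require Import all_classical all_reals all_analysis.
From mathcomp Require Import ring lra zify.
Import Order.TTheory GRing.Theory Num.Theory.
Import numFieldNormedType.Exports.
Local Open Scope classical_set_scope.
Local Open Scope ring_scope.

(* The tree is drawn with axis-parallel edges, by recursion on rooted subtrees.
   A subtree S with root at the corner (0, 0) of a box of width w and height h,
   meeting m lattice points, is drawn so that m + w + h < 2|S|. Two such branches
   at a common root are placed side by side, one of them on a vertical edge with
   its short side along the x axis, the other at the end of a horizontal edge that
   is long enough to pass it. The lattice points on that edge are paid for by the
   overlap of the two heights. Since the root is a leaf, every vertex has at most
   two branches, and the whole tree meets at most 2n lattice points.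
   The drawing is carried to the realizations by f(p) = grid_point (x p) (y p),
   where x and y extend the coordinates of the vertices barycentrically and
   grid_point (X, Y) has the coordinate tent(X - i) * tent(Y - j) at (i, j).
   This map is continuous and injective, hence an embedding by compactness. *)

(** * Drawings of trees *)

Section Drawing.
Set Implicit Arguments.
Unset Strict Implicit.
Unset Printing Implicit Defensive.
Variables (R : realType) (V : finType) (e : rel V).
Implicit Types (S : {set V}) (p q : {ptws V -> R}) (x y : V -> int).

Definition barycenter (c : V -> int) p : R := \sum_v p v * (c v)%:~R.

Lemma barycenter_segment (c : V -> int) u v t :
  barycenter c (segment_point u v t) = (1 - t) * (c u)%:~R + t * (c v)%:~R.
Proof.
have sumb a : \sum_w basis_point R a w * (c w)%:~R = (c a)%:~R.
  rewrite (bigD1 a) //= /basis_point eqxx mul1r big1 ?addr0 // => w /negPf wa.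
  by rewrite wa mul0r.
rewrite -(sumb u) -(sumb v) !mulr_sumr -big_split /=.
by apply: eq_bigr => w _; rewrite /segment_point; ring.
Qed.

Lemma segment_point0 u v : segment_point u v 0 = basis_point R u :> {ptws V -> R}.
Proof. by apply/funext => w; rewrite /segment_point; ring. Qed.

Lemma segment_point1 u v : segment_point u v 1 = basis_point R v :> {ptws V -> R}.
Proof. by apply/funext => w; rewrite /segment_point; ring. Qed.

Lemma segment_pointC u v t :
  segment_point u v t = segment_point v u (1 - t) :> {ptws V -> R}.
Proof. by apply/funext => w; rewrite /segment_point; ring. Qed.

(* The case [u == v] makes the vertices of [S] degenerate segments. *)
Definition spoint S p :=
  exists u v t, [/\ u \in S, v \in S, (u == v) || e u v, 0 <= t <= 1
                  & p = segment_point u v t].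

Lemma spoint_vertex S v : v \in S -> spoint S (basis_point R v).
Proof.
move=> Sv; exists v, v, 0; split=> //; rewrite ?eqxx ?lexx ?ler01 //.
by rewrite segment_point0.
Qed.

(** The weights [1 - t] and [t] sum to 1, so a translation of the vertices translates every point of
    the drawing. *)
Lemma barycenter_shift S (c c' : V -> int) (k : int) p :
    (forall v, v \in S -> c v = c' v + k) -> spoint S p ->
  barycenter c p = barycenter c' p + k%:~R.
Proof.
move=> cc' [u [v [t [Su Sv _ _ ->]]]].
by rewrite !barycenter_segment !cc' // !intrD; ring.
Qed.

Lemma barycenter_eq S (c c' : V -> int) p :
  {in S, c =1 c'} -> spoint S p -> barycenter c p = barycenter c' p.
Proof.
move=> cc' Sp; rewrite (@barycenter_shift S c c' 0) ?addr0 // => v Sv.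
by rewrite addr0 cc'.
Qed.

(* Straight-line drawing of the part [S] of the graph by axis-parallel
   segments in the box [0, w] x [0, h], with [r] at the corner [(0, 0)]; [M]
   contains the lattice points that the drawing meets. *)
Record drawing S r x y (w h : nat) (M : seq (int * int)) : Prop := Drawing {
  drawing_root : x r = 0 /\ y r = 0;
  drawing_box p : spoint S p -> 0 <= barycenter x p <= w%:R /\
                                0 <= barycenter y p <= h%:R;
  drawing_grid p : spoint S p ->
    (exists k : int, barycenter x p = k%:~R) \/
    (exists k : int, barycenter y p = k%:~R);
  drawing_inj p q : spoint S p -> spoint S q ->
    barycenter x p = barycenter x q -> barycenter y p = barycenter y q -> p = q;
  drawing_met p (i j : int) : spoint S p ->
    barycenter x p = i%:~R -> barycenter y p = j%:~R -> (i, j) \in M }.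

(** Inside the box of a drawing this leaves the positive x axis free for one more edge at the
    root. *)
Definition axis_clear S x y := forall p : {ptws V -> R},
  spoint S p -> barycenter y p = 0 -> barycenter x p = 0.

Definition swap_pair (z : int * int) := (z.2, z.1).

Lemma drawing_swap S r x y w h M :
  drawing S r x y w h M -> drawing S r y x h w (map swap_pair M).
Proof.
case=> [[xr yr] box grid inj met]; split => //.
- by move=> p /box [].
- by move=> p /grid [] ?; [right|left].
- by move=> p q Sp Sq xpq ypq; apply: inj.
- by move=> p i j Sp xi yj; apply/mapP; exists (j, i) => //; apply: met Sp _ _.
Qed.

Lemma spoint_set1 r p : spoint [set r]%SET p -> p = basis_point R r.
Proof.
move=> [u [v [t [/set1P -> /set1P -> _ _ ->]]]].
by apply/funext => w; rewrite /segment_point; ring.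
Qed.

Lemma drawing_set1 r :
  drawing [set r]%SET r (fun=> 0) (fun=> 0) 0 0 [:: (0, 0)].
Proof.
have b0 p : spoint [set r]%SET p -> barycenter (fun=> 0) p = 0.
  by move=> _; rewrite /barycenter big1 // => v _; rewrite mulr0.
split => //.
- by move=> p /b0 ->; rewrite lexx.
- by move=> p /b0 ->; left; exists 0.
- by move=> p q /spoint_set1 -> /spoint_set1 ->.
- move=> p i j /b0 -> /esym/eqP; rewrite intr_eq0 => /eqP ->.
  by move=> /esym/eqP; rewrite intr_eq0 => /eqP ->; rewrite inE.
Qed.

Lemma axis_clear_set1 r : axis_clear [set r]%SET (fun=> 0) (fun=> 0).
Proof. by []. Qed.

(** * Joining two drawings by a horizontal edge *)

(** An edge between the two parts can only be [r c]. Its ends are already points of [S1] and [S2],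
    so only the open segment is new. *)
Lemma spointU S1 S2 (r c : V) p : symmetric e ->
    r \in S1 -> c \in S2 -> e r c ->
    (forall u v, u \in S1 -> v \in S2 -> e u v -> u = r /\ v = c) ->
    [disjoint S1 & S2]%B ->
    spoint (S1 :|: S2)%SET p ->
  [\/ spoint S1 p, spoint S2 p
    | exists2 t : R, 0 < t < 1 & p = segment_point r c t].
Proof.
move=> sym_e S1r S2c erc only dis.
have edge t : 0 <= t <= 1 -> p = segment_point r c t ->
    [\/ spoint S1 p, spoint S2 p
      | exists2 t : R, 0 < t < 1 & p = segment_point r c t].
  move=> /andP[]; rewrite le_eqVlt => /predU1P[<- _ ->|t0].
    by apply: Or31; rewrite segment_point0; apply: spoint_vertex.
  rewrite le_eqVlt => /predU1P[-> ->|t1 ->].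
    by apply: Or32; rewrite segment_point1; apply: spoint_vertex.
  by apply: Or33; exists t; rewrite ?t0.
have dis' u : u \in S1 -> u \in S2 -> False.
  by move=> S1u S2u; move/pred0P/(_ u): dis => /=; rewrite S1u S2u.
move=> [u [v [t [+ + uv t01 pE]]]]; rewrite !inE.
case/orP=> Su; case/orP=> Sv.
- by apply: Or31; exists u, v, t.
- case/predU1P: uv => [uv|uv]; first by case: (dis' u Su); rewrite uv.
  by case: (only u v) => // ur vc; apply: (edge t) => //; rewrite -ur -vc.
- case/predU1P: uv => [uv|uv]; first by case: (dis' u _ Su); rewrite uv.
  rewrite sym_e in uv.
  case: (only v u) => // ur vc; apply: (edge (1 - t)); first by lra.
  by rewrite -ur -vc -segment_pointC.
- by apply: Or32; exists u, v, t.
Qed.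

Definition glue S2 (c1 c2 : V -> int) (k : int) : V -> int :=
  fun v => if v \in S2 then c2 v + k else c1 v.

Lemma barycenter_glue1 S1 S2 (c1 c2 : V -> int) (k : int) p :
    [disjoint S1 & S2]%B -> spoint S1 p ->
  barycenter (glue S2 c1 c2 k) p = barycenter c1 p.
Proof.
move=> dis; apply: barycenter_eq => v S1v.
by rewrite /glue (disjointFr dis S1v).
Qed.

Lemma barycenter_glue2 S2 (c1 c2 : V -> int) (k : int) p : spoint S2 p ->
  barycenter (glue S2 c1 c2 k) p = barycenter c2 p + k%:~R.
Proof. by apply: barycenter_shift => v S2v; rewrite /glue S2v. Qed.

(** The last list consists of the lattice points strictly inside the edge from [(0, 0)] to
    [(w + 1, 0)]. *)
Definition joined_points (w : nat) (M1 M2 : seq (int * int)) :=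
  M1 ++ [seq (z.1 + w.+1%:Z, z.2) | z <- M2] ++
  [seq (i%:Z, 0) | i <- iota 1 w].

Lemma size_joined_points w M1 M2 :
  size (joined_points w M1 M2) = (size M1 + size M2 + w)%N.
Proof. by rewrite !size_cat !size_map size_iota addnA. Qed.

Section Join.
Variables (S1 S2 : {set V}) (r c : V) (x1 y1 x2 y2 : V -> int).
Variables (w1 h1 w2 h2 : nat) (M1 M2 : seq (int * int)).
Hypotheses (sym_e : symmetric e) (S1r : r \in S1) (S2c : c \in S2) (erc : e r c)
  (only : forall u v, u \in S1 -> v \in S2 -> e u v -> u = r /\ v = c)
  (dis : [disjoint S1 & S2]%B)
  (draw1 : drawing S1 r x1 y1 w1 h1 M1) (draw2 : drawing S2 c x2 y2 w2 h2 M2)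
  (clear1 : axis_clear S1 x1 y1).

Let x := glue S2 x1 x2 w1.+1%:Z.
Let y := glue S2 y1 y2 0.

Let S2r : r \in S2 = false. Proof. exact: disjointFr dis S1r. Qed.

Let x_edge t : barycenter x (segment_point r c t) = t * w1.+1%:R.
Proof.
rewrite barycenter_segment /x /glue S2c S2r.
case: (drawing_root draw1) => -> _; case: (drawing_root draw2) => -> _.
by rewrite mulr0 !add0r.
Qed.

Let y_edge t : barycenter y (segment_point r c t) = 0.
Proof.
rewrite barycenter_segment /y /glue S2c S2r.
case: (drawing_root draw1) => _ ->; case: (drawing_root draw2) => _ ->.
by rewrite !mulr0 !add0r.
Qed.

Let split_spoint p := @spointU S1 S2 r c p sym_e S1r S2c erc only dis.

Let x_on1 p (Sp : spoint S1 p) := barycenter_glue1 x1 x2 w1.+1%:Z dis Sp.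
Let y_on1 p (Sp : spoint S1 p) := barycenter_glue1 y1 y2 0 dis Sp.
Let x_on2 p (Sp : spoint S2 p) := barycenter_glue2 x1 x2 w1.+1%:Z Sp.
Let y_on2 p (Sp : spoint S2 p) : barycenter y p = barycenter y2 p.
Proof. by rewrite (barycenter_glue2 y1 y2 0 Sp) addr0. Qed.

(** The first drawing and the open edge have abscissa below [w1 + 1], the second drawing at least
    [w1 + 1], so neither meets the second drawing. The open edge lies on the positive x axis, which
    [clear1] keeps free of the first drawing. *)
Lemma drawing_join :
  drawing (S1 :|: S2)%SET r x y (w1 + 1 + w2) (maxn h1 h2) (joined_points w1 M1 M2).
Proof.
have w1S : w1.+1%:R = w1%:R + 1 :> R by rewrite -natr1.
have w1Z : w1.+1%:Z%:~R = w1%:R + 1 :> R by rewrite -w1S.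
have w1_ge0 : 0 <= w1%:R :> R by [].
have w2_ge0 : 0 <= w2%:R :> R by [].
have edge_bounds (t : R) : 0 < t < 1 -> 0 < t * (w1%:R + 1) < w1%:R + 1.
  have w1_gt0 : 0 < w1%:R + 1 :> R by lra.
  by move=> /andP[t0 t1]; rewrite mulr_gt0 //= gtr_pMl.
have hmax : h1%:R <= (maxn h1 h2)%:R :> R /\ h2%:R <= (maxn h1 h2)%:R :> R.
  by rewrite !ler_nat leq_maxl leq_maxr.
split.
- rewrite /x /y /glue S2r; exact: drawing_root draw1.
- move=> p /split_spoint[Sp|Sp|[t t01 ->]].
  + rewrite x_on1 // y_on1 // !natrD.
    have := drawing_box draw1 Sp; move: hmax w2_ge0; lra.
  + rewrite x_on2 // y_on2 // !natrD w1Z.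
    have := drawing_box draw2 Sp; move: hmax w1_ge0; lra.
  + rewrite x_edge y_edge !natrD w1S.
    have := edge_bounds _ t01.
    have : 0 <= h1%:R :> R by []. move: hmax w2_ge0; lra.
- move=> p /split_spoint[Sp|Sp|[t t01 ->]].
  + by rewrite x_on1 // y_on1 //; exact: (drawing_grid draw1 Sp).
  + rewrite x_on2 // y_on2 //; case: (drawing_grid draw2 Sp) => [[k ->]|]; last by right.
    by left; exists (k + w1.+1%:Z); rewrite intrD.
  + by right; exists 0; rewrite y_edge.
- have cross p q : spoint S1 p \/ (exists2 t : R, 0 < t < 1 & p = segment_point r c t) ->
      spoint S2 q -> barycenter x p <> barycenter x q.
    move=> + Sq; rewrite (x_on2 Sq) w1Z.
    have [xq _] := drawing_box draw2 Sq.
    case=> [Sp|[t /edge_bounds t01 ->]].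
      rewrite (x_on1 Sp); have [xp _] := drawing_box draw1 Sp; lra.
    rewrite x_edge w1S; lra.
  have cross' p t : spoint S1 p -> 0 < t < 1 ->
      barycenter x p = barycenter x (segment_point r c t) ->
      barycenter y p = barycenter y (segment_point r c t) -> False.
    move=> Sp /edge_bounds t01; rewrite x_edge y_edge (x_on1 Sp) (y_on1 Sp).
    by move=> xp /(clear1 Sp); rewrite xp w1S; lra.
  move=> p q /split_spoint Hp /split_spoint Hq xpq ypq.
  case: Hp => [Sp|Sp|[t t01 pE]]; case: Hq => [Sq|Sq|[s s01 qE]].
  + by apply: (drawing_inj draw1) => //; move: xpq ypq; rewrite !x_on1 ?y_on1.
  + by case: (cross p q) => //; left.
  + by case: (cross' p s); rewrite -?qE.
  + by case: (cross q p) => //; left.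
  + by apply: (drawing_inj draw2) => //; move: xpq ypq; rewrite !x_on2 ?y_on2 // => /addIr.
  + by case: (cross q p) => //; right; exists s.
  + by case: (cross' q t); rewrite -?pE.
  + by case: (cross p q) => //; right; exists t.
  + have w1_neq0 : w1.+1%:R != 0 :> R by rewrite pnatr_eq0.
    by move: xpq; rewrite pE qE !x_edge => /(mulIf w1_neq0) ->.
- move=> p i j /split_spoint[Sp|Sp|[t t01 ->]]; rewrite !mem_cat.
  + by rewrite x_on1 // y_on1 // => xi yj; rewrite (drawing_met draw1 Sp xi yj).
  + rewrite x_on2 // y_on2 // => xi yj.
    have {}xi : barycenter x2 p = (i - w1.+1%:Z)%:~R by rewrite intrB -xi addrK.
    apply/orP; right; apply/orP; left; apply/mapP.
    by exists (i - w1.+1%:Z, j); rewrite ?(drawing_met draw2 Sp xi yj) ?subrK.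
  + rewrite x_edge y_edge => xi /esym/eqP; rewrite intr_eq0 => /eqP ->.
    have := edge_bounds _ t01; rewrite -w1S xi ltr0z -[w1.+1%:R]/(w1.+1%:Z%:~R) ltr_int.
    move=> /andP[i_gt0 i_lt]; apply/orP; right; apply/orP; right; apply/mapP.
    by exists `|i|%N; rewrite ?mem_iota ?gtz0_abs //; lia.
Qed.

(** The second drawing has positive abscissa and the edge has ordinate 0, so a join adds nothing to
    the y axis off the root. Transposing then makes the x axis clear. *)
Lemma axis_clear_join : axis_clear S1 y1 x1 -> axis_clear (S1 :|: S2)%SET y x.
Proof.
move=> clear p /split_spoint[Sp|Sp|[t t01 ->]].
- by rewrite x_on1 // y_on1 //; apply: clear.
- rewrite x_on2 // => x0; have [+ _] := drawing_box draw2 Sp.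
  have : 0 < w1.+1%:R :> R by rewrite ltr0n.
  move: x0; rewrite -[w1.+1%:Z%:~R]/(w1.+1%:R); lra.
- by rewrite y_edge.
Qed.

End Join.

(** * Drawings of small total cost *)

Definition attached (S1 S2 : {set V}) (r c : V) :=
  [/\ r \in S1, c \in S2, e r c,
      forall u v, u \in S1 -> v \in S2 -> e u v -> u = r /\ v = c
    & [disjoint S1 & S2]%B].

(** The one-point drawing of [r] is joined to [S] by a unit edge. The result is transposed, so that
    this edge is vertical and the x axis is clear for a second branch. *)
Lemma drawing_extend S r c x y w h M : symmetric e ->
    attached [set r]%SET S r c -> drawing S c x y w h M ->
  exists x' y' M', [/\ drawing ([set r] :|: S)%SET r x' y' h w.+1 M',
    axis_clear ([set r] :|: S)%SET x' y' & size M' = (size M).+1].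
Proof.
move=> sym_e [r1 Sc erc only dis] draw.
have [clear0 draw0] := (@axis_clear_set1 r, drawing_set1 r).
have dj := drawing_join sym_e r1 Sc erc only dis draw0 draw clear0.
have cj := axis_clear_join sym_e r1 Sc erc only dis draw0 draw clear0.
move/drawing_swap: dj; rewrite max0n add0n add1n => dj.
do 3!eexists; split; [exact: dj|exact: cj|].
by rewrite size_map size_joined_points /= add1n addn0.
Qed.

(** The box sides count because they bound the length of later connecting edges. The bound is
    [2 * #|S| - 1]: adding a root then allows an increase of 2 over one branch and of 3 over the sum
    of two branches. *)
Definition frugal S r := exists x y w h M,
  drawing S r x y w h M /\ (size M + w + h < 2 * #|S|)%N.

(* Transposing turns the box so that its short side runs along the x axis. *)
Lemma frugal_narrow S r : frugal S r -> exists x y w h M,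
  [/\ drawing S r x y w h M, (w <= h)%N & (size M + w + h < 2 * #|S|)%N].
Proof.
move=> [x [y [w [h [M [draw szM]]]]]]; have [wh|/ltnW hw] := leqP w h.
  by exists x, y, w, h, M.
exists y, x, h, w, (map swap_pair M); split=> //; first exact: drawing_swap.
by rewrite size_map -addnA (addnC h) addnA.
Qed.

Lemma frugal_set1 r : frugal [set r]%SET r.
Proof.
do 5!eexists; split; first exact: drawing_set1.
by rewrite cards1.
Qed.

Lemma frugal_extend S r c : symmetric e ->
  attached [set r]%SET S r c -> frugal S c -> frugal ([set r] :|: S)%SET r.
Proof.
move=> sym_e att [x [y [w [h [M [draw szM]]]]]].
have [x' [y' [M' [draw' _ szM']]]] := drawing_extend sym_e att draw.
do 5!eexists; split; first exact: draw'.
have [r1 _ _ _ dis] := att; rewrite cardsU1 (disjointFr dis) ?inE // szM'.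
by move: szM; lia.
Qed.

(* The first branch lies on a vertical edge at the root, with its short side
   [w1] along the x axis; the second one is reached by a horizontal edge of length
   [w1 + 1]. As [w1 <= h1] and [w1 <= h2], the [w1] lattice points inside that
   edge are compensated by the overlap of the heights of the two branches. *)
Lemma frugal_fork S1 S2 r c1 c2 : symmetric e ->
    attached [set r]%SET S1 r c1 -> attached ([set r] :|: S1)%SET S2 r c2 ->
    attached [set r]%SET S2 r c2 -> attached ([set r] :|: S2)%SET S1 r c1 ->
    frugal S1 c1 -> frugal S2 c2 ->
  frugal ([set r] :|: S1 :|: S2)%SET r.
Proof.
move=> sym_e a1 a12 a2 a21.
move=> /frugal_narrow[x1 [y1 [w1 [h1 [M1 [draw1 wh1 sz1]]]]]].
move=> /frugal_narrow[x2 [y2 [w2 [h2 [M2 [draw2 wh2 sz2]]]]]].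
(* If [h2 < w1], then [w2 <= h2 <= w1 <= h1], and the branches can trade places. *)
wlog w12 : S1 S2 c1 c2 a1 a12 a2 a21 x1 y1 w1 h1 M1 draw1 wh1 sz1
    x2 y2 w2 h2 M2 draw2 wh2 sz2 / (w1 <= h2)%N => [th|].
  have [w12|/ltnW h21] := leqP w1 h2.
    exact: (th S1 S2 c1 c2 _ _ _ _ x1 y1 w1 h1 M1 _ _ _ x2 y2 w2 h2 M2).
  rewrite -finset.setUA (finset.setUC S1) finset.setUA.
  apply: (th S2 S1 c2 c1 _ _ _ _ x2 y2 w2 h2 M2 _ _ _ x1 y1 w1 h1 M1) => //.
  by apply: leq_trans wh2 (leq_trans h21 wh1).
(* [drawing_extend] transposes once more, so swapping first puts the short side [w1] along the x
   axis. *)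
have [x [y [M [draw clear szM]]]] := drawing_extend sym_e a1 (drawing_swap draw1).
have [Sr S2c erc only dis] := a12.
do 5!eexists; split.
  exact: drawing_join sym_e Sr S2c erc only dis draw draw2 clear.
have [r1 _ _ _ dis1] := a1.
rewrite size_joined_points szM size_map cardsU disjoint_setI0 // cards0 subn0.
rewrite cardsU1 (disjointFr dis1) ?inE //.
by move: sz1 sz2 wh1 wh2 w12; lia.
Qed.

(** * Decomposition of a rooted subtree into branches *)

Definition inner (A : {set V}) : rel V := [rel a b | [&& e a b, a \in A & b \in A]].

(** For [A = S :\ r] and a neighbor [c] of [r] in [S], this is the subtree hanging from [r] at
    [c]. *)
Definition branch (A : {set V}) c := [set v | connect (inner A) c v]%SET.

Lemma branch_refl (A : {set V}) c : c \in branch A c.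
Proof. by rewrite inE. Qed.

Lemma branch_sub (A : {set V}) c : c \in A -> branch A c \subset A.
Proof.
move=> Ac; apply/fintype.subsetP => v; rewrite inE => /connectP[p + ->] {v}.
by elim: p c Ac => //= b p IH c Ac /andP[/and3P[_ _ Ab]]; apply: IH.
Qed.

Lemma inner_sym (A : {set V}) : symmetric e -> symmetric (inner A).
Proof. by move=> sym_e u v; rewrite /inner /= sym_e [(u \in A) && _]andbC. Qed.

Lemma branch_closed (A : {set V}) c u v :
  u \in A -> v \in A -> u \in branch A c -> e u v -> v \in branch A c.
Proof.
rewrite !inE => Au Av cu uv; apply: (connect_trans cu); apply: connect1.
by rewrite /inner /= uv Au.
Qed.

Definition connected_from S r := forall v, v \in S -> connect (inner S) r v.

(** A walk in [A] that starts in the branch never leaves it. *)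
Lemma branch_connected (A : {set V}) c : connected_from (branch A c) c.
Proof.
have walk s u : u \in branch A c -> path (inner A) u s ->
    path (inner (branch A c)) u s.
  elim: s u => //= v s IH u cu /andP[uv pth].
  have cv : v \in branch A c.
    by move: cu; rewrite !inE => cu; apply: connect_trans cu (connect1 uv).
  by rewrite IH // andbT; apply/and3P; split=> //; case/and3P: uv.
move=> v; rewrite inE => /connectP[p pth vE]; apply/connectP; exists p => //.
by apply: walk pth; apply: branch_refl.
Qed.

(** A simple path from [c] to [c'] inside the branch avoids [r], so [r] closes it to a cycle unless
    the path is trivial. *)
Lemma branch_neighbor S r c c' : symmetric e -> acyclic e ->
    e r c -> e r c' -> c \in (S :\ r)%SET -> c' \in branch (S :\ r)%SET c ->
  c = c'.
Proof.
move=> sym_e acyc rc rc' Ac; rewrite inE => /connectP[p0 p0P cE].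
move: rc'; rewrite cE; case/shortenP: p0P => p pth uniq_p _ rc'.
have Ap : all [in (S :\ r)%SET] (c :: p).
  rewrite /= Ac; elim: p c pth Ac {uniq_p rc rc' cE} => //= b p IH c.
  by move=> /andP[/and3P[_ _ Ab] pth] _; rewrite Ab (IH b).
(* Acyclicity bounds the size [2 + size p] by 2, so [p] is empty and [c'], the last vertex, is
   [c]. *)
suff /acyc : ucycle e [:: r, c & p] by case: p {pth uniq_p Ap rc'}.
rewrite /ucycle cons_uniq uniq_p andbT; apply/andP; split.
  rewrite /= rc rcons_path sym_e rc' andbT.
  by apply: sub_path pth => u v /and3P[].
by apply/negP => /(allP Ap); rewrite !inE eqxx.
Qed.

(** On a simple path from [r] to [v], the vertex after [r] serves as [c], since the rest of the path
    avoids [r]. *)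
Lemma branch_cover S r v : connected_from S r -> v \in S -> v != r ->
  exists c, [/\ e r c, c \in (S :\ r)%SET & v \in branch (S :\ r)%SET c].
Proof.
move=> conn Sv vr; case/connectP: (conn v Sv) => p0 p0P vE.
case/shortenP: p0P vE => -[|c p] /= pth; first by move=> _ _ vE; rewrite vE eqxx in vr.
rewrite inE negb_or => /andP[/andP[rc rp] uniq_p] _ vE.
case/andP: pth => /and3P[erc _ Sc] pth; exists c.
have Ac : c \in (S :\ r)%SET by rewrite !inE eq_sym rc.
split=> //; rewrite inE; apply/connectP; exists p => //.
elim: p c {erc rc Sc uniq_p vE} pth rp Ac => //= b p IH c /andP[/and3P[cb _ Sb] pth].
rewrite inE negb_or => /andP[rb rp] Ac.
have Ab : b \in (S :\ r)%SET by rewrite !inE eq_sym rb.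
by rewrite IH // /inner /= cb Ac Ab.
Qed.

Lemma branch_attached S r c : symmetric e -> acyclic e ->
    e r c -> c \in (S :\ r)%SET ->
  attached [set r]%SET (branch (S :\ r)%SET c) r c.
Proof.
move=> sym_e acyc rc Ac; split; rewrite ?branch_refl ?inE //.
- by move=> u v /set1P -> bv rv; split=> //; rewrite (branch_neighbor sym_e acyc rc rv Ac bv).
- rewrite disjoints1; apply/negP => /(fintype.subsetP (branch_sub Ac)).
  by rewrite !inE eqxx.
Qed.

(** A common vertex of the two branches, or an edge between them, would put [c2] into the branch of
    [c1], against [branch_neighbor]. *)
Lemma branch_attachedU S r c1 c2 : symmetric e -> acyclic e ->
    e r c1 -> c1 \in (S :\ r)%SET -> e r c2 -> c2 \in (S :\ r)%SET -> c1 != c2 ->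
  attached ([set r] :|: branch (S :\ r)%SET c1)%SET (branch (S :\ r)%SET c2) r c2.
Proof.
move=> sym_e acyc rc1 Ac1 rc2 Ac2 c12.
have [r1 bc _ only dis] := branch_attached sym_e acyc rc2 Ac2.
have connC := sym_connect_sym (inner_sym (S :\ r)%SET sym_e).
have sep v : v \in branch (S :\ r)%SET c1 -> v \in branch (S :\ r)%SET c2 -> False.
  rewrite !inE => c1v; rewrite connC => vc2.
  move/negP: c12; apply; apply/eqP; apply: branch_neighbor sym_e acyc rc1 rc2 Ac1 _.
  by rewrite inE; apply: connect_trans vc2.
split=> //; first by rewrite !inE eqxx.
- move=> u v; rewrite finset.in_setU => /orP[/set1P ->|b1u] b2v uv; first exact: only r1 b2v uv.
  have Au := fintype.subsetP (branch_sub Ac1) _ b1u.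
  have Av := fintype.subsetP (branch_sub Ac2) _ b2v.
  by case: (sep v) => //; apply: branch_closed uv.
- apply/pred0P => v /=; rewrite finset.in_setU; apply/negP => /andP[].
  case/orP=> [/set1P ->|b1v b2v]; last exact: sep b1v b2v.
  by rewrite (disjointFr dis r1).
Qed.

(** * Recursion over rooted subtrees *)

(** Induction on [#|S|]: the root has zero, one or two branches, handled by [frugal_set1],
    [frugal_extend] and [frugal_fork]. *)
Lemma frugal_tree S r : symmetric e -> irreflexive e -> acyclic e ->
    (max_degree e <= 3)%N -> r \in S -> connected_from S r ->
    (#|[set c in S | e r c]%SET| <= 2)%N ->
  frugal S r.
Proof.
move=> sym_e irr_e acyc deg3.
have [n] := ubnP #|S|; elim: n S r => // n IH S r szS Sr conn deg2.
set A := (S :\ r)%SET.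
have nbrP c : (c \in [set c in S | e r c]%SET) = (c \in A) && e r c.
  by rewrite !inE; case: eqP => // ->; rewrite irr_e andbF.
have rec c : e r c -> c \in A -> frugal (branch A c) c.
  move=> rc Ac; have sub := branch_sub Ac; apply: IH.
  - apply: leq_ltn_trans (subset_leq_card sub) _.
    by move: szS; rewrite (cardsD1 r S) Sr.
  - exact: branch_refl.
  - exact: branch_connected.
  (* One of the at most three neighbors of [c] is [r], which lies outside the branch, so two
     remain. *)
  - have : (degree e c <= 3)%N by apply: leq_trans deg3; apply: leq_bigmax.
    rewrite /degree (cardsD1 r) inE sym_e rc ltnS; apply: leq_trans.
    apply: subset_leq_card; apply/fintype.subsetP => u; rewrite !inE.
    move=> /andP[cu ->]; rewrite andbT.
    have : u \in A by apply: (fintype.subsetP sub); rewrite inE.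
    by rewrite !inE => /andP[].
have SE : S = ([set r] :|: \bigcup_(c in [set c in S | e r c]) branch A c)%SET.
  apply/setP => v; rewrite finset.in_setU inE; case: eqVneq => [->|vr] //=.
  apply/idP/finset.bigcupP => [Sv|[c]].
    have [c [rc Ac bv]] := branch_cover conn Sv vr.
    by exists c; rewrite // nbrP rc Ac.
  rewrite nbrP => /andP[Ac rc] /(fintype.subsetP (branch_sub Ac)).
  by rewrite !inE => /andP[].
rewrite SE; move: deg2 nbrP; set N := [set c in S | e r c]%SET => deg2 nbrP.
have [N0|[c Nc]] := finset.set_0Vmem N.
  by rewrite N0 finset.big_set0 finset.setU0; apply: frugal_set1.
have /andP[Ac rc] : (c \in A) && e r c by rewrite -nbrP.
have [N0|[d]] := finset.set_0Vmem (N :\ c)%SET.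
  rewrite (finset.big_setD1 c) //= N0 finset.big_set0 finset.setU0.
  exact: frugal_extend sym_e (branch_attached sym_e acyc rc Ac) (rec c rc Ac).
move=> NDd; have := NDd; rewrite 2!inE => /andP[dc Nd].
have /andP[Ad rd] : (d \in A) && e r d by rewrite -nbrP.
have N2 : (N :\ c :\ d)%SET = finset.set0.
  apply/eqP; rewrite -cards_eq0; move: deg2.
  by rewrite (cardsD1 c) Nc (cardsD1 d) NDd; lia.
rewrite (finset.big_setD1 c) //= (finset.big_setD1 d) //= N2 finset.big_set0.
rewrite finset.setU0 finset.setUA.
have cd : c != d by rewrite eq_sym.
apply: frugal_fork (rec c rc Ac) (rec d rd Ad) => //.
- exact: branch_attached.
- exact: branch_attachedU.
- exact: branch_attached.
- exact: branch_attachedU.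
Qed.

(** A simple path grows at its first vertex until that vertex has degree at most 1. It cannot reach
    [#|V|] edges, as it would have [#|V| + 1] distinct vertices. *)
Lemma tree_leaf : is_tree e -> exists r, (degree e r <= 1)%N.
Proof.
move=> [sym_e irr_e /card_gt0P[r0 _] conn acyc].
have grow k : exists (x : V) (p : seq V), [/\ path e x p, uniq (x :: p) &
    (size p = k)%N \/ (degree e x <= 1)%N].
  elim: k => [|k [x [p [pth up [szp|dx]]]]].
  - by exists r0, [::]; split=> //; left.
  - have [dx|dx] := leqP (degree e x) 1; first by exists x, p; split=> //; right.
    suff [y xy yp] : exists2 y : V, e x y & y \notin p.
      exists y, (x :: p); split; rewrite /= ?szp; last by left.
        by rewrite sym_e xy.
      move: up => /= ->; rewrite inE negb_or yp !andbT; apply/negP => /eqP yx.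
      by rewrite yx irr_e in xy.
    (* If all neighbors of [x] lie on [p], each is the head of [p], since a later one would close a
       cycle of at least 3 vertices. Then [x] has degree at most 1. *)
    apply: contrapT => no; move: dx; rewrite ltnNge => /negP; apply.
    rewrite -(cards1 (head x p)); apply: subset_leq_card.
    apply/fintype.subsetP => y; rewrite !inE => xy.
    have /splitPr yp : y \in p by apply: contrapT => /negP yp; apply: no; exists y.
    case: yp xy pth up => p1 p2 xy pth up.
    have /acyc : ucycle e (x :: rcons p1 y).
      rewrite /ucycle /=; move: pth up; rewrite -cat_rcons /= cat_path cat_uniq => /andP[pth _].
      by rewrite rcons_path last_rcons pth sym_e xy /= mem_cat negb_or => /andP[/andP[-> _] /andP[-> _]].
    by rewrite /= size_rcons; case: p1 {pth up} => //=; rewrite eqxx.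
  - by exists x, p; split=> //; right.
have [x [p [_ up [szp|dx]]]] := grow #|V|; last by exists x.
have := card_uniqP up; rewrite /= szp => E.
by have := max_card [in x :: p]; rewrite E ltnn.
Qed.

Lemma tree_drawing : is_tree e -> (max_degree e <= 3)%N ->
  exists x y M r w h, drawing [set: V]%SET r x y w h M /\ (size M <= 2 * #|V|)%N.
Proof.
move=> tree_e deg3; have [r deg_r] := tree_leaf tree_e.
have [sym_e irr_e _ conn acyc] := tree_e.
have [|||x [y [w [h [M [draw sz]]]]]] := @frugal_tree [set: V]%SET r sym_e irr_e acyc deg3.
- by rewrite inE.
- move=> v _; apply: connect_sub (conn r v) => a b ab.
  by apply: connect1; rewrite /inner /= ab !inE.
- apply: leq_trans (leq_trans deg_r _) => //; apply: subset_leq_card.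
  by apply/fintype.subsetP => c; rewrite !inE.
exists x, y, M, r, w, h; split=> //.
by move: sz; rewrite cardsT; lia.
Qed.
End Drawing.

(** * Topology of realizations *)

Section Topology.
Set Implicit Arguments.
Unset Strict Implicit.
Unset Printing Implicit Defensive.

Lemma hausdorff_inj (X Y : topologicalType) (f : X -> Y) :
  continuous f -> injective f -> hausdorff_space Y -> hausdorff_space X.
Proof.
move=> cf injf hY p q clpq; apply/injf/hY => A B /cf fA /cf fB.
by have [x [Ax Bx]] := clpq _ _ fA fB; exists (f x).
Qed.

Lemma set_type_hausdorff (X : topologicalType) (A : set X) :
  hausdorff_space X -> hausdorff_space (set_type A).
Proof.
apply: (@hausdorff_inj _ _ set_val); first exact: initial_continuous.
by move=> x y /val_inj.
Qed.

(** The image filter in [X] clusters at a point of [A]. Open sets of the subspace are traces of open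
    sets of [X], so the filter clusters there in the subspace too. *)
Lemma set_type_compact (X : topologicalType) (A : set X) :
  compact A -> compact [set: set_type A].
Proof.
move=> cA F FF _.
have [|p [Ap clp]] := cA (set_val @ F) _.
  by rewrite /nbhs /=; apply: filterE => x; exact: set_valP.
exists (exist _ p (mem_set Ap)); split=> // B C FB [_ /= [[D oD <-] Dp DC]].
have FB' : (set_val @ F) (set_val @` B) by apply: (@filterS _ F _ B) => // x Bx; exists x.
have [|_ [[x Bx <-] Dx]] := clp _ D FB'; first exact: open_nbhs_nbhs.
by exists x; split=> //; apply: DC.
Qed.

Lemma compact_embedding (X Y : topologicalType) (f : X -> Y) :
    compact [set: X] -> hausdorff_space Y -> continuous f -> injective f ->
  topological_embedding f.
Proof.
move=> cX hY cf injf; split=> //; split.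
  exact: (@continuous_comp_initial (set_type (range f)) X Y set_val).
have gP (y : set_type (range f)) : exists x, f x = set_val y.
  by have [x _ xy] := set_valP y; exists x.
have [g gE] := choice gP; exists g; split.
- by move=> x; apply: injf; rewrite gE.
- by move=> y; apply: val_inj; exact: gE.
- apply/continuous_closedP => C clC.
  have -> : g @^-1` C = set_val @^-1` (f @` C).
    apply/seteqP; split=> y /= => [Cy|[x Cx fx]]; first by exists (g y); rewrite ?gE.
    by rewrite (_ : g y = x) //; apply: injf; rewrite gE.
  have /continuous_closedP clV := @initial_continuous (set_type (range f)) Y set_val.
  apply: clV.
  apply: compact_closed => //; apply: continuous_compact.
    exact: continuous_subspaceT.
  exact: subclosed_compact clC cX _.
Qed.

Lemma ptws_continuous (X : topologicalType) (I : Type) (R : topologicalType)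
    (f : X -> {ptws I -> R}) :
  (forall i, continuous (fun x => f x i)) -> continuous f.
Proof.
move=> cf x; apply/cvg_sup => i.
by apply: (@continuous_comp_initial {ptws I -> R} X R (fun g => g i)); exact: cf.
Qed.

Lemma ptws_eval_continuous (I : Type) (R : topologicalType) (i : I) :
  continuous (fun p : {ptws I -> R} => p i).
Proof. exact: (@proj_continuous {classic I} (fun=> R) i). Qed.

(** The realization is a finite union of continuous images of [[0, 1]]; the pairs [(v, v)]
    contribute the vertices. *)
Lemma realization_compact (R : realType) (V : finType) (e : rel V) :
  compact [set: realization R e].
Proof.
apply: set_type_compact.
pose seg (a : V * V) : set {ptws V -> R} := segment_point a.1 a.2 @` `[0, 1].
have -> : realization_set R e = \bigcup_(a in [set a : V * V | (a.1 == a.2) || e a.1 a.2]) seg a.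
  apply/seteqP; split=> p.
    case=> [[v ->]|[u [v [t [uv t01 ->]]]]].
      exists (v, v); rewrite /= ?eqxx //; exists 0 => /=; first by rewrite in_itv /= lexx ler01.
      by rewrite segment_point0.
    exists (u, v); rewrite /= ?uv ?orbT //; exists t => //=; by rewrite in_itv.
  move=> [[u v] /= /orP[/eqP <-|uv] [t /= t01 <-]].
    by left; exists u; apply/funext => w; rewrite /segment_point; ring.
  by right; exists u, v, t; split=> //; move: t01; rewrite /= in_itv.
rewrite bigcup_fset_set; last exact: finite_finset.
apply: (@big_ind _ compact); [exact: compact0|exact: compactU|move=> [u v] _].
apply: continuous_compact; last exact: segment_compact.
apply: continuous_subspaceT; apply: ptws_continuous => w.
move=> t; rewrite /segment_point.
apply: cvgD; apply: cvgM; try exact: cvg_cst; last exact: cvg_id.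
by apply: cvgB; [exact: cvg_cst|exact: cvg_id].
Qed.

Lemma realization_hausdorff (R : realType) (V : eqType) (e : rel V) :
  hausdorff_space (realization R e).
Proof.
apply: set_type_hausdorff.
by apply: (@hausdorff_product V (fun=> R)) => _; exact: Rhausdorff.
Qed.
End Topology.

(** * Tent coordinates on the grid *)

Section GridPoint.
Set Implicit Arguments.
Unset Strict Implicit.
Unset Printing Implicit Defensive.
Variable R : realType.
Implicit Types s X Y : R.

Definition tent s : R := Num.max 0 (1 - `|s|).

Lemma tent_ge0 s : 0 <= tent s.
Proof. by rewrite le_max lexx. Qed.

Lemma tent_gt0 s : (0 < tent s) = (`|s| < 1).
Proof. by rewrite lt_max ltxx subr_gt0. Qed.

(** On [[j, j + 1]] only the tents at [j] and [j + 1] can be nonzero, and they are the barycentric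
    coordinates of that unit segment. *)
Lemma tent_floor s (j k : int) : 0 <= s <= 1 ->
  tent (j%:~R + s - k%:~R) = (1 - s) * (k == j)%:R + s * (k == j + 1)%:R.
Proof.
move=> s01; rewrite /tent.
have [->|kj] := eqVneq k j.
  rewrite [_ + s]addrC addrK (_ : (j == j + 1) = false) ?ger0_norm; [|by case/andP: s01|lia].
  by rewrite /= mulr1 mulr0 addr0 max_r //; lra.
have [->|kj1] := eqVneq k (j + 1).
  rewrite intrD mulr1z (_ : j%:~R + s - (j%:~R + 1) = s - 1); last by ring.
  by rewrite /= mulr1 mulr0 add0r ler0_norm ?max_r; lra.
rewrite max_l; first by rewrite !mulr0 addr0.
rewrite subr_le0 ler_normr.
have [kj2|kj2] : (k <= j - 1)%R \/ (j + 2 <= k)%R by lia.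
  by move: kj2; rewrite -(ler_int R) intrB; lra.
by move: kj2; rewrite -(ler_int R) intrD; lra.
Qed.

Lemma tent_int (j k : int) : tent (j%:~R - k%:~R) = (k == j)%:R.
Proof.
by rewrite -[j%:~R]addr0 tent_floor ?lexx ?ler01 // subr0 mul1r mul0r addr0.
Qed.

(* The tents are a partition of unity with first moment [s]; this recovers [s]
   from its tent coordinates. *)
Lemma tent_moments s : `|s| < 1 ->
  tent (s - 1) + tent s + tent (s + 1) = 1 /\ tent (s - 1) - tent (s + 1) = s.
Proof.
rewrite ltr_norml => /andP[s1 s2]; rewrite /tent.
have -> : `|s - 1| = 1 - s by rewrite ler0_norm; lra.
have -> : `|s + 1| = 1 + s by rewrite ger0_norm; lra.
have [s0|s0] := lerP 0 s.
  rewrite ger0_norm // (@max_r _ _ 0 (1 - (1 - s))) ?(@max_l _ _ 0 (1 - (1 + s))) ?(@max_r _ _ 0 (1 - s)); lra.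
rewrite ltr0_norm // (@max_l _ _ 0 (1 - (1 - s))) ?(@max_r _ _ 0 (1 - (1 + s))) ?(@max_r _ _ 0 (1 - - s)); lra.
Qed.

(* On the grid these are the barycentric coordinates of the point [(X, Y)]. *)
Definition grid_point X Y : {ptws (int * int) -> R} :=
  fun z => tent (X - z.1%:~R) * tent (Y - z.2%:~R).

Lemma grid_point_int (i j : int) : grid_point i%:~R j%:~R = basis_point R (i, j).
Proof.
apply/funext => -[k l]; rewrite /grid_point /basis_point /= !tent_int.
by rewrite -natrM mulnb.
Qed.

(** The coordinate at the lower left corner [(i, j)] of the cell of [(X, Y)] is positive, so
    [(X', Y')] is also within distance 1 of it in each coordinate. The values on the 3 by 3 block
    around [(i, j)] then determine both points. *)
Lemma grid_point_inj X Y X' Y' :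
  grid_point X Y = grid_point X' Y' -> X = X' /\ Y = Y'.
Proof.
move=> g_eq; pose i := Num.floor X; pose j := Num.floor Y.
have g z : grid_point X Y z = grid_point X' Y' z by rewrite g_eq.
have floor_lt (x : R) : `|x - (Num.floor x)%:~R| < 1.
  by have := floor_itv x; rewrite intrD ltr_norml; lra.
have Xi := floor_lt X; have Yj := floor_lt Y.
have [X'i Y'j] : `|X' - i%:~R| < 1 /\ `|Y' - j%:~R| < 1.
  have : 0 < grid_point X' Y' (i, j) by rewrite -g mulr_gt0 ?tent_gt0.
  rewrite /grid_point /= -!tent_gt0 => gt0; split; rewrite lt_neqAle tent_ge0 andbT eq_sym;
    by apply: contraTneq gt0 => ->; rewrite ?mulr0 ?mul0r ltxx.
(* Summing over one direction gives 1 by the partition of unity; the first moment in the other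
   direction gives the offset from [i] or [j]. *)
have moments A B : `|A - i%:~R| < 1 -> `|B - j%:~R| < 1 ->
    let gp k l := grid_point A B (i + k, j + l) in
    A = i%:~R + (gp 1 (-1) + gp 1 0 + gp 1 1) - (gp (-1) (-1) + gp (-1) 0 + gp (-1) 1) /\
    B = j%:~R + (gp (-1) 1 + gp 0 1 + gp 1 1) - (gp (-1) (-1) + gp 0 (-1) + gp 1 (-1)).
  move=> /tent_moments[a1 am] /tent_moments[b1 bm] /=.
  rewrite /grid_point /= !intrD !addr0.
  rewrite !opprD !addrA !mulrNz !opprK.
  set a := tent (A - _ - 1); set a' := tent (A - _ + 1).
  set b := tent (B - _ - 1); set b' := tent (B - _ + 1).
  rewrite -/a -/a' -/b -/b' in a1 am b1 bm.
  split.
    rewrite (_ : _ - _ = i%:~R + (a - a') * (b + tent (B - j%:~R) + b')); last by ring.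
    by rewrite b1 am; ring.
  rewrite (_ : _ - _ = j%:~R + (b - b') * (a + tent (A - i%:~R) + a')); last by ring.
  by rewrite a1 bm; ring.
have [XE YE] := moments X Y Xi Yj; have [XE' YE'] := moments X' Y' X'i Y'j.
by rewrite !g in XE YE; split; [rewrite XE -XE'|rewrite YE -YE'].
Qed.

(** If one coordinate is an integer, the point lies on the grid edge starting at the floor of the
    other one, with its fractional part as parameter. *)
Lemma grid_point_in X Y : (exists k : int, X = k%:~R) \/ (exists k : int, Y = k%:~R) ->
  grid_point X Y \in realization_set R grid_adj.
Proof.
have fl (x : R) : exists2 s : R, 0 <= s <= 1 & x = (Num.floor x)%:~R + s.
  exists (x - (Num.floor x)%:~R); last by ring.
  by have := floor_itv x; rewrite intrD; lra.
move=> H; apply/mem_set; right; case: H => [[k ->]|[k ->]].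
- have [s s01 YE] := fl Y; exists (k, Num.floor Y), (k, Num.floor Y + 1), s; split=> //.
    by apply/eqP; rewrite /= subrr; ring.
  apply/funext => -[a b]; rewrite /grid_point /segment_point {1}YE tent_int tent_floor //.
  rewrite /basis_point /= !xpair_eqE -!mulnb !natrM; ring.
- have [s s01 XE] := fl X; exists (Num.floor X, k), (Num.floor X + 1, k), s; split=> //.
    by apply/eqP; rewrite /= subrr; ring.
  apply/funext => -[a b]; rewrite /grid_point /segment_point {1}XE tent_int tent_floor //.
  rewrite /basis_point /= !xpair_eqE -!mulnb !natrM; ring.
Qed.

Lemma tent_continuous : continuous tent.
Proof.
move=> s; apply: (@continuous_max R R^o (fun=> 0) (fun s => 1 - `|s|)); first exact: cvg_cst.
by apply: cvgB; [exact: cvg_cst|apply: cvg_norm; exact: cvg_id].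
Qed.

Lemma grid_point_continuous (T : topologicalType) (f g : T -> R) :
  continuous f -> continuous g -> continuous (fun x => grid_point (f x) (g x)).
Proof.
move=> cf cg; apply: ptws_continuous => z x; rewrite /grid_point.
have ct (h : T -> R) (k : int) : continuous h -> continuous (fun y : T => tent (h y - k%:~R)).
  move=> ch y; apply: (@continuous_comp _ _ _ (fun y => h y - k%:~R) tent).
    by apply: cvgB; [exact: ch|exact: cvg_cst].
  exact: tent_continuous.
by apply: cvgM; apply: ct.
Qed.
End GridPoint.

(** * The embedding of the tree *)

Lemma spoint_realization (R : realType) (V : finType) (e : rel V)
    (p : {ptws V -> R}) : realization_set R e p -> spoint e [set: V]%SET p.
Proof.
case=> [[v ->]|[u [v [t [uv t01 ->]]]]].
  by apply: spoint_vertex; rewrite inE.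
by exists u, v, t; split; rewrite ?inE ?uv ?orbT.
Qed.

Lemma barycenter_continuous (R : realType) (V : finType) (c : V -> int) :
  continuous (@barycenter R V c).
Proof.
have cadd : continuous (fun z : R^o * R^o => z.1 + z.2) by exact: add_continuous.
apply: (@continuous_big R^o V +%R 0 xpredT cadd {ptws V -> R} _ (fun v p => p v * (c v)%:~R)).
move=> v _ p; have pv := @ptws_eval_continuous V R v p.
exact: cvgM pv (cvg_cst _).
Qed.

Theorem mainTheorem1 (R : realType) (V : finType) (e : rel V) (n : nat)
    (tree_e : is_tree e) (card_V : #|V| = n) (deg_e : (max_degree e <= 3)%N) :
  exists f : realization R e -> realization R grid_adj,
    [/\ topological_embedding f,
        (forall v : V, exists z : int * int,
           f (vertex R e v) = vertex R grid_adj z),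
        finite_set (vertices_met f) &
        (#|` fset_set (vertices_met f)|)%fset%:R <= 7 / 3 * n%:R :> R].
Proof.
have [x [y [M [r [w [h [draw szM]]]]]]] := @tree_drawing R V e tree_e deg_e.
pose g (p : realization R e) :=
  grid_point (barycenter x (set_val p)) (barycenter y (set_val p)).
pose f p : realization R grid_adj := exist _ (g p)
  (grid_point_in (drawing_grid draw (spoint_realization (set_valP p)))).
have bary_v (c : V -> int) v : barycenter c (basis_point R v) = (c v)%:~R.
  by rewrite -(segment_point0 R v v) barycenter_segment; ring.
have met_M : vertices_met f `<=` [set` M].
  (* The vertex [(i, j)] is [grid_point i j], so by injectivity a point mapped to it has barycenters
     [i] and [j]. *)
  move=> [i j] [p _ /(congr1 set_val)]; rewrite -[set_val (vertex _ _ _)]grid_point_int.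
  by move=> /grid_point_inj[xi yj]; apply: drawing_met draw _ _ _ (spoint_realization (set_valP p)) xi yj.
have fin_met : finite_set (vertices_met f) by apply: sub_finite_set met_M (finite_seq M).
exists f; split => //.
- apply: compact_embedding.
  + exact: realization_compact.
  + exact: realization_hausdorff.
  + apply: (@continuous_comp_initial (realization R grid_adj) _ _ set_val).
    have cV : continuous (set_val : realization R e -> _) by exact: initial_continuous.
    by apply: grid_point_continuous => p; apply: continuous_comp (cV p) _;
      exact: barycenter_continuous.
  + move=> p q /(congr1 set_val) /grid_point_inj[xpq ypq]; apply: val_inj.
    exact: drawing_inj draw _ _ (spoint_realization (set_valP p)) (spoint_realization (set_valP q)) xpq ypq.
- move=> v; exists (x v, y v); apply: val_inj.
  by rewrite /= /g /= !bary_v grid_point_int.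
- have le_met : (#|` fset_set (vertices_met f)| <= 2 * n)%N.
    rewrite -card_V; apply: leq_trans szM.
    apply: leq_trans (size_undup M); rewrite -(card_fseq M).
    apply: fsubset_leq_card; apply/fsubsetP => z.
    by rewrite in_fset_set // inE => /met_M /=; rewrite !inE.
  (* The drawing gives the bound [2 * n], which is stronger than [7 / 3 * n]. *)
  apply: (@le_trans _ _ (2 * n)%:R); first by rewrite ler_nat.
  have n_ge0 : 0 <= n%:R :> R by [].
  by rewrite natrM; lra.
Qed.
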